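(* Let $\alpha>0$ and let $m\ge 2$ be a fixed integer. Let $\xi_1,\dots,\xi_m$ be i.i.d. random variables with density $e^{-x}I(x\ge 0)$, and let $\mu$ be the probability measure on $\mathbb{R}$ that is the law of $$\frac{\alpha}{2}\cdot\frac{\xi_1^2+\cdots+\xi_m^2}{(\xi_1+\cdots+\xi_m)^2}.$$ For each $n$, let $\kappa$ be chosen according to the uniform distribution on $\mathcal{P}_n(m)$, or, alternatively, according to the uniform distribution on $\mathcal{P}_n'(m)$. Then, in either case, $\frac{\lambda_\kappa}{n^2}\to\mu$ weakly (i.e. in distribution) as $n\to\infty$.
   Context: A partition $\kappa\vdash n$ is a non-increasing sequence of positive integers with sum $n$; its length is its number of (positive) parts. $\mathcal{P}_n(m)$ is the set of partitions of $n$ with length at most $m$, and $\mathcal{P}_n'(m)$ is the set of partitions of $n$ with length exactly $m$. A partition of length at most $m$ is written $\kappa=(k_1,\dots,k_m)$ with $k_1\ge\cdots\ge k_m\ge 0$ (padded with zeros if necessary). $\kappa'$ denotes the transpose (conjugate) partition, with parts $k_i'$, and $$a(\kappa)=\sum_{i\ge1}(i-1)k_i=\sum_{i\ge1}\binom{k_i'}{2}.$$ The eigenvalue associated with $\kappa$ (of the Laplace–Beltrami operator in $m$ variables with parameter $\alpha$) is $$\lambda_\kappa=n(m-1)+a(\kappa')\alpha-a(\kappa).$$ *)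

(* Defs.v *)
From HB Require Import structures.
From mathcomp Require Import all_boot all_order all_algebra.
From mathcomp Require Import finmap.
From mathcomp Require Import all_classical all_reals all_analysis.
From mathcomp Require Import measurable_realfun.

Set Implicit Arguments.
Unset Strict Implicit.
Unset Printing Implicit Defensive.

Import Order.TTheory GRing.Theory Num.Theory.
Import numFieldNormedType.Exports.

Local Open Scope classical_set_scope.
Local Open Scope ring_scope.

Definition is_intpart (s : seq nat) : bool := sorted geq s && (0%N \notin s).

Record intpart := IntPart { parts :> seq nat; _ : is_intpart parts }.

HB.instance Definition _ := [isSub for parts].
HB.instance Definition _ := [Choice of intpart by <:].

Definition intpart0 : intpart := @IntPart [::] isT.

HB.instance Definition _ := isPointed.Build intpart intpart0.

HB.instance Definition _ := @isMeasurable.Build default_measure_display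
  intpart discrete_measurable discrete_measurable0
  discrete_measurableC discrete_measurableU.

Definition partitions_le (n m : nat) : set intpart :=
  [set k | sumn k = n /\ (size k <= m)%N].

Definition partitions_eq (n m : nat) : set intpart :=
  [set k | sumn k = n /\ size k = m].

(* The j-th part of the transpose (j counted from 0) is the number of parts
   greater than j; the transpose has as many parts as the largest part. *)
Definition conj_parts (s : seq nat) : seq nat :=
  [seq count (fun k => j < k)%N s | j <- iota 0 (head 0%N s)].

(* Positions are counted from 0, hence the weight i instead of i - 1. *)
Definition part_a (s : seq nat) : nat := (\sum_(i < size s) i * nth 0 s i)%N.

Definition eigenvalue_of {R : realType} (alpha : R) (m : nat) (k : intpart) : R :=
  (sumn k)%:R * (m%:R - 1) + (part_a (conj_parts k))%:R * alpha
  - (part_a k)%:R.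

Definition scaled_eigenvalue {R : realType} (alpha : R) (m n : nat)
    (k : intpart) : R :=
  eigenvalue_of alpha m k / n%:R ^+ 2.

Lemma measurable_scaled_eigenvalue {R : realType} (alpha : R) (m n : nat) :
  measurable_fun [set: intpart] (scaled_eigenvalue alpha m n).
Proof. by []. Qed.

HB.instance Definition _ (R : realType) (alpha : R) (m n : nat) :=
  isMeasurableFun.Build _ _ _ _ (scaled_eigenvalue alpha m n)
    (measurable_scaled_eigenvalue alpha m n).

(* The uniform distribution on S, for S finite and nonempty; otherwise it is,
   by convention, the Dirac measure at the empty partition (see uniform_onE
   and finite_partitions_le below). *)
Definition uniform_on {R : realType} (S : set intpart) : set intpart -> \bar R :=
  mnormalize (mrestr (@counting intpart R) (I : measurable S)) (dirac intpart0).

HB.instance Definition _ (R : realType) (S : set intpart) :=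
  Probability.on (@uniform_on R S).

Lemma finite_partitions_le (n m : nat) : finite_set (partitions_le n m).
Proof.
pose g (t : m.-tuple 'I_n.+1) : intpart :=
  insubd intpart0 [seq x <- map val t | x != 0%N].
apply: (@sub_finite_set _ _ (g @` [set: m.-tuple 'I_n.+1])); last first.
  exact/finite_image/finite_finset.
move=> k [nk mk]; exists [tuple inord (nth 0%N k i) | i < m] => //.
have k_le x : x \in parts k -> (x <= n)%N.
  by rewrite -nk; elim: (parts k) => //= y s IH; rewrite inE => /predU1P[->|/IH];
    [rewrite leq_addr | move/leq_trans; apply; rewrite leq_addl].
rewrite /g (_ : map val _ = mkseq (nth 0%N k) m); last first.
  rewrite /= /mkseq -val_enum_ord -!map_comp.
  apply: eq_map => i /=; rewrite inordK// ltnS.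
  have [ik|ik] := ltnP i (size k); last by rewrite nth_default.
  exact/k_le/mem_nth.
have -> : mkseq (nth 0%N k) m = parts k ++ nseq (m - size k) 0%N.
  apply: (@eq_from_nth _ 0%N) => [|i].
    by rewrite size_mkseq size_cat size_nseq subnKC.
  rewrite size_mkseq => im; rewrite nth_mkseq// nth_cat nth_nseq.
  by case: ltnP => // ik; rewrite nth_default//; case: ifP.
rewrite filter_cat (_ : seq.filter _ (nseq _ _) = [::]); last first.
  by elim: (_ - _)%N.
rewrite cats0 (_ : seq.filter _ _ = parts k) ?valKd//.
apply/all_filterP/allP => x xk; case/andP: (valP k) => _.
by apply: contraNneq => x0; rewrite -x0.
Qed.

Lemma finite_partitions_eq (n m : nat) : finite_set (partitions_eq n m).
Proof.
apply: sub_finite_set (finite_partitions_le n m) => k [nk mk].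
by split=> //; rewrite mk.
Qed.

Lemma uniform_onE {R : realType} (S A : set intpart) :
  finite_set S -> S !=set0 ->
  uniform_on S A =
  (#|` fset_set (S `&` A)|%:R / #|` fset_set S|%:R : R)%:E.
Proof.
move=> finS [k Sk]; rewrite /uniform_on /mnormalize /= /mrestr setTI.
have finA : finite_set (A `&` S) by exact: finite_setIr.
rewrite /counting !asboolT// orbF eqe pnatr_eq0 cardfs_eq0.
rewrite ifF ?asboolT// ?[S `&` A]setIC//.
by apply/negbTE/fset0Pn; exists k; rewrite in_fset_set// inE.
Qed.

Section mutual_independence.
Context d (T : measurableType d) d' (T' : measurableType d') (R : realType).

Definition mutually_independent (P : probability T R) (I : finType)
    (X : I -> {RV P >-> T'}) : Prop :=
  forall (J : {set I}) (A : I -> set T'), (forall i, measurable (A i)) ->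
  P (\bigcap_(i in [set` J]) (X i @^-1` A i)) =
  (\prod_(i in J) P (X i @^-1` A i))%E.

End mutual_independence.
Arguments mutually_independent {d T d' T' R} P {I} X.

Definition has_density {d} {T : measurableType d} {R : realType}
    (P : probability T R) (X : {RV P >-> R}) (f : R -> R) : Prop :=
  forall A : set R, measurable A ->
  distribution P X A = (\int[lebesgue_measure]_(x in A) (f x)%:E)%E.
Arguments has_density {d T R} P X f.

Definition limit_stat {d} {T : measurableType d} {R : realType} (alpha : R)
    (m : nat) (xi : 'I_m -> {mfun T >-> R}) (w : T) : R :=
  alpha / 2 * ((\sum_(i < m) xi i w ^+ 2) / (\sum_(i < m) xi i w) ^+ 2).

Lemma measurable_limit_stat {d} {T : measurableType d} {R : realType}
    (alpha : R) (m : nat) (xi : 'I_m -> {mfun T >-> R}) :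
  measurable_fun [set: T] (limit_stat alpha xi).
Proof.
have measurable_inv : measurable_fun [set: R] (fun x : R => x^-1).
  have openD0 : open (~` [set 0 : R]) by exact/closed_openC/closed_eq.
  rewrite -(setvU [set 0 : R]); apply/measurable_funU => //.
    exact: open_measurable.
  split; last exact: measurable_fun_set1.
  apply: open_continuous_measurable_fun => // x /set_mem /= x0.
  by apply: inv_continuous; apply/eqP.
apply: measurable_funM; first exact: measurable_cst.
apply: measurable_funM; first by apply: measurable_sum => i; exact: measurable_funX.
apply: (measurableT_comp measurable_inv); apply: measurable_funX.
exact: measurable_sum.
Qed.

HB.instance Definition _ d (T : measurableType d) (R : realType) (alpha : R)
    (m : nat) (xi : 'I_m -> {mfun T >-> R}) :=
  isMeasurableFun.Build _ _ _ _ (limit_stat alpha xi)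
    (measurable_limit_stat alpha xi).

Definition weakly_converges {R : realType} (nu : nat -> probability R R)
    (mu : probability R R) : Prop :=
  forall f : R -> R, continuous f -> bounded_fun f ->
  (fun n => \int[nu n]_x (f x)%:E)%E @ \oo --> (\int[mu]_x (f x)%:E)%E.

(* Main.v *)
Require Import Defs.
From HB Require Import structures.
From mathcomp Require Import all_boot all_order all_algebra.
From mathcomp Require Import finmap.
From mathcomp Require Import all_classical all_reals all_analysis.
From mathcomp Require Import measurable_realfun.
From mathcomp Require Import zify ring lra.

(** Since a(kappa') is the sum of the binomials (k_i choose 2) and a(kappa) is at
    most m n, the scaled eigenvalue is, up to an error of order 1/n, the number
    alpha/2 times the ratio of k_1^2 + ... + k_m^2 to (k_1 + ... + k_m)^2
    ([part_a_conj], [scaled_eigenvalue_approx]). The ratio does not change when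
    the parts are permuted, so that a partition may be replaced by a composition
    of n into m ordered parts, zero parts allowed. A partition with m distinct
    positive parts comes from exactly m! compositions, and the compositions with
    a zero or a repeated part make up a fraction O(1/n) of all. Hence uniform
    compositions and uniform partitions, with at most or with exactly m parts,
    have the same limit ([sum_comparison], [mean_partitions_cvg]).

    For uniform compositions of n, let u(n) be the mean of f at the ratio.

    The sequence u converges for every continuous f ([mean_cvg]). When f is a
    power, the sum over compositions is an iterated convolution of powers, hence
    a polynomial in n of known degree, and so is the number of compositions;
    their quotient converges after scaling. Polynomials follow by linearity, and
    continuous functions on [0, 1] by Bernstein approximation.

    Its limit is the mean of f at the ratio of the exponential variables
    ([integral_variable_ratio]). Round each variable down to a lattice of mesh
    1/(j+1). The rounded variables, in units of the mesh, are independent and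
    geometric, with the same parameter, so that given their sum they form a
    uniform composition of it. The mean of f at the ratio of the rounded
    variables is therefore the mean of u at their sum. As j grows, the rounded
    ratio converges to the ratio of the exponential variables and the sum tends
    to infinity, so that dominated convergence on both sides identifies the limit
    of u. *)

Set Implicit Arguments.
Unset Strict Implicit.
Unset Printing Implicit Defensive.

Import Order.TTheory GRing.Theory Num.Theory.
Import numFieldNormedType.Exports.

Local Open Scope classical_set_scope.
Local Open Scope ring_scope.

(** * Compositions of an integer *)

(** Zero parts are allowed: these are the points of the dilated simplex, listed
    by first part so that sums over them are iterated convolutions. *)
Fixpoint compositions (m n : nat) : seq (seq nat) :=
  if m is m'.+1 then [seq j :: s | j <- iota 0 n.+1, s <- compositions m' (n - j)]
  else if n == 0%N then [:: [::]] else [::].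

Arguments compositions : simpl never.

Lemma mem_compositions m n s : (s \in compositions m n) = (size s == m) && (sumn s == n).
Proof.
elim: m n s => [|m IH] n s.
  by case: s => [|x s]; case: n => [|n].
apply/allpairsPdep/idP => [[j [t [+ + ->]]]|].
  rewrite mem_iota IH /= add0n ltnS eqSS => jn /andP[-> /eqP ->].
  by rewrite subnKC ?eqxx.
case: s => // j t /andP[/eqP[st] /eqP sn].
exists j, t; split=> //; first by rewrite mem_iota add0n ltnS -sn /= leq_addr.
by rewrite IH st -sn /= addKn !eqxx.
Qed.

Lemma compositions_uniq m n : uniq (compositions m n).
Proof.
elim: m n => [|m IH] n; first by case: n.
apply: allpairs_uniq_dep => [|j _|]; rewrite ?iota_uniq ?IH//.
by move=> [i s] [j t] _ _ /= [-> ->].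
Qed.

Lemma big_compositions (V : Type) (idx : V) (op : Monoid.law idx) (g : seq nat -> V) m n :
  \big[op/idx]_(s <- compositions m.+1 n) g s =
  \big[op/idx]_(j < n.+1) \big[op/idx]_(s <- compositions m (n - j)) g ((j : nat) :: s).
Proof. by rewrite big_allpairs_dep -[n.+1]subn0 -/(index_iota _ _) big_mkord subn0. Qed.

Lemma sum_binomial_diagonal b n :
  (\sum_(j < n.+1) 'C(j + b, b) = 'C(n + b.+1, b.+1))%N.
Proof.
elim: n => [|n IHn]; first by rewrite big_ord1 !add0n !binn.
by rewrite big_ord_recr /= IHn [RHS]binS addSnnS.
Qed.

(** The product of the generating functions (1 - x)^-(a+1) and (1 - x)^-(b+1). *)
Lemma sum_binomial_convolution a b n :
  (\sum_(j < n.+1) 'C(j + a, a) * 'C(n - j + b, b) = 'C(n + (a + b).+1, (a + b).+1))%N.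
Proof.
elim: a n => [n|a IHa n].
  rewrite -sum_binomial_diagonal (reindex_inj rev_ord_inj) /=.
  apply: eq_bigr => i _; rewrite bin0 mul1n.
  by have := ltn_ord i => ?; congr ('C(_, _)); lia.
elim: n => [|n IHn]; first by rewrite big_ord1 /= !add0n !binn.
(* Pascal's rule on the first factor; both sides obey the same recursion. *)
have -> : (\sum_(j < n.+2) 'C(j + a.+1, a.+1) * 'C(n.+1 - j + b, b) =
  \sum_(j < n.+2) 'C(j + a, a) * 'C(n.+1 - j + b, b) +
  \sum_(j < n.+1) 'C(j + a.+1, a.+1) * 'C(n - j + b, b))%N.
  rewrite big_ord_recl [X in (_ = X + _)%N]big_ord_recl /= !add0n !binn -addnA.
  congr (_ + _)%N; rewrite -big_split /=; apply: eq_bigr => i _.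
  by rewrite /bump /= add1n subSS addSn addnS binS mulnDl addnC addSn.
rewrite IHa IHn [RHS](_ : _ = 'C((n.+1 + (a + b).+1).+1, (a + b).+2)).
  by rewrite binS addnC; congr ('C(_, _) + 'C(_, _))%N; lia.
by congr ('C(_, _)); lia.
Qed.

Lemma size_compositions m n : size (compositions m.+1 n) = 'C(n + m, m).
Proof.
elim: m n => [|m IH] n.
  rewrite -sum1_size big_compositions bin0 big_ord_recr /= subnn big_seq1 big1 ?add0n// => i _.
  by rewrite /compositions (_ : (n - i == 0)%N = false) ?big_nil//; have := ltn_ord i; lia.
rewrite -sum1_size big_compositions -(@sum_binomial_convolution 0 m) /=.
by apply: eq_bigr => i _; rewrite sum1_size IH bin0 mul1n.
Qed.

(** * Compositions with a zero or a repeated part *)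

(** The generic compositions into m parts are the rearrangements, m! for each, of
    the partitions into m distinct positive parts. *)
Definition generic (s : seq nat) := uniq s && (0%N \notin s).

Lemma sum_compositions_shift m n :
  (\sum_(j < n.+1) size (compositions m (n - j)) = size (compositions m.+1 n))%N.
Proof.
rewrite -[RHS]sum1_size big_compositions.
by apply: eq_bigr => i _; rewrite sum1_size.
Qed.

(** The left side counts the compositions [j :: t] of [n] in which the first part
    occurs again, with multiplicity. For each position of [t] where it occurs,
    merging the two equal parts gives a composition of [n] with one part less,
    from which they can be recovered; the induction adds up the resulting bounds
    over the positions. *)
Lemma sum_count_mem_compositions m n :
  (\sum_(j < n.+1) \sum_(t <- compositions m (n - j)) count_mem (j : nat) t <=
   m * size (compositions m n))%N.
Proof.
elim: m n => [|m IH] n.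
  rewrite big1// => j _; rewrite /compositions; case: (n - j == 0)%N => /=.
    by rewrite big_seq1.
  by rewrite big_nil.
under eq_bigr => j _.
  rewrite big_compositions /=; over.
under eq_bigr do under eq_bigr do rewrite big_split /=.
under eq_bigr do rewrite big_split /=.
rewrite big_split /= mulSn leq_add//.
  (* The next part equals the first part j: the others compose n - 2j, and
     distinct j give distinct 2j. *)
  rewrite -sum_compositions_shift.
  have E (j : 'I_n.+1) : (\sum_(i < (n - j).+1)
      \sum_(t <- compositions m (n - j - i)) (i == j :> nat) <=
      \sum_(i < n.+1 | i == (2 * j)%N :> nat) size (compositions m (n - i)))%N.
    have [jn|jn] := leqP (2 * j) n.
      have jj : (j < (n - j).+1)%N by lia.
      rewrite (bigD1 (Ordinal jj)) //= [X in (_ + X)%N]big1 ?addn0; last first.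
        move=> i ij; rewrite big1// => _ _; case: eqP => // ijv.
        by case/eqP: ij; exact: val_inj.
      have jj2 : (2 * j < n.+1)%N by lia.
      rewrite (bigD1 (Ordinal jj2)) //= eqxx sum1_size.
      by rewrite (_ : n - j - j = n - 2 * j)%N ?leq_addr//; lia.
    rewrite big1// => i _; rewrite (_ : (i == j :> nat) = false) ?big1//.
    by apply/negbTE; have := ltn_ord i; lia.
  apply: (@leq_trans (\sum_(j < n.+1) \sum_(i < n.+1 | i == (2 * j)%N :> nat)
    size (compositions m (n - i)))%N); first by apply: leq_sum => j _; exact: E.
  rewrite (exchange_big_dep xpredT) //=; apply: leq_sum => i _.
  rewrite sum_nat_const -[leqRHS]mul1n leq_mul2r; apply/orP; right.
  apply: leq_trans (subset_leq_card (_ : _ \subset pred1 (inord i./2))) _; last by rewrite card1.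
  apply/fintype.subsetP => j; rewrite !inE => /eqP ij; apply/eqP/val_inj => /=.
  by rewrite inordK ij mul2n doubleK.
have -> : (\sum_(i < n.+1) \sum_(i0 < (n - i).+1)
    \sum_(i1 <- compositions m (n - i - i0)) count_mem (i : nat) i1 =
  \sum_(i0 < n.+1) \sum_(i < (n - i0).+1)
    \sum_(i1 <- compositions m (n - i0 - i)) count_mem (i : nat) i1)%N.
  have W (F : nat -> nat -> nat) : (\sum_(i < n.+1) \sum_(j < (n - i).+1) F i j =
    \sum_(i < n.+1) \sum_(j < n.+1 | (i + j <= n)%N) F i j)%N.
    apply: eq_bigr => i _.
    rewrite (big_ord_widen_cond n.+1 xpredT (F i)) //=; last by have := ltn_ord i; lia.
    by apply: eq_bigl => j /=; have := ltn_ord i; lia.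
  rewrite (W (fun i j => \sum_(i1 <- compositions m (n - i - j)) count_mem i i1)%N).
  rewrite (W (fun j i => \sum_(i1 <- compositions m (n - j - i)) count_mem i i1)%N).
  rewrite (exchange_big_dep xpredT) //=; apply: eq_bigr => i _.
  rewrite (eq_bigl (fun j : 'I_n.+1 => (i + j <= n)%N)); last by move=> j; rewrite addnC.
  by apply: eq_bigr => j _; rewrite subnAC.
rewrite -sum_compositions_shift big_distrr /=.
by apply: leq_sum => i _; exact: IH.
Qed.

(** A coincidence between two parts, or a vanishing part, costs one dimension:
    non-generic compositions are at most a constant times as many as the
    compositions with one part less. *)
Lemma count_nongeneric_compositions m n :
  (count (predC generic) (compositions m.+1 n) <= m.+1 * m.+1 * size (compositions m n))%N.
Proof.
have H k N (B : nat -> nat) :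
  (forall l, count (predC generic) (compositions k l) <= B l)%N ->
  (count (predC generic) (compositions k.+1 N) <=
   \sum_(j < N.+1) B (N - j) + k.+1 * size (compositions k N))%N.
  move=> hB; rewrite -sum1_count big_mkcond big_compositions /=.
  have E (j : nat) t : ((if predC generic (j :: t) then 1 else 0) <=
    (if predC generic t then 1 else 0) + ((j == 0) + count_mem j t))%N.
    have cE : (j \in t) = (0 < count_mem j t)%N by rewrite -has_pred1 has_count.
    move: (count_mem j t) cE => c cE.
    rewrite /generic /= in_cons cE [0%N == j]eq_sym.
    by case: c (uniq t) (0%N \in t) (j == 0%N) {cE} => [|c] [] [] [].
  apply: (@leq_trans (\sum_(j < N.+1) \sum_(t <- compositions k (N - j))
    ((if predC generic t then 1 else 0) + ((j == 0%N :> nat) + count_mem (j : nat) t))))%N.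
    by apply: leq_sum => j _; apply: leq_sum => t _; exact: E.
  under [leqLHS]eq_bigr do rewrite big_split /= big_split /=.
  rewrite big_split big_split /= mulSn; apply: leq_add.
    apply: leq_sum => j _; rewrite -big_mkcond sum1_count; exact: hB.
  apply: leq_add; last exact: sum_count_mem_compositions.
  rewrite big_ord_recl [X in (_ + X)%N]big1 ?addn0 ?subn0; last first.
    by move=> i _; rewrite big1.
  by rewrite /= sum1_size.
elim: m n => [|m IH] n.
  apply: leq_trans (H 0 n (fun=> 0%N) _) _ => [l|].
    by case: l.
  by rewrite big1// add0n.
apply: leq_trans (H m.+1 n _ IH) _.
rewrite -[X in (X + _)%N]big_distrr /= sum_compositions_shift -mulnDl leq_mul2r.
by apply/orP; right; lia.
Qed.

(** * Sequences that are polynomial in n *)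

Section binomial_sums.
Variable R : realType.
Implicit Types (u v : nat -> R) (D : nat).

(** The polynomials in [n] of degree at most [D], in the basis in which
    convolution is explicit. *)
Definition binomial_sum D u :=
  exists c : nat -> R, forall n, u n = \sum_(i < D.+1) c i * 'C(n + i, i)%:R.

Lemma eq_binomial_sum D u v : u =1 v -> binomial_sum D u -> binomial_sum D v.
Proof. by move=> uv [c cE]; exists c => n; rewrite -uv cE. Qed.

Lemma binomial_sumD D u v : binomial_sum D u -> binomial_sum D v ->
  binomial_sum D (fun n => u n + v n).
Proof.
move=> [c cE] [e eE]; exists (fun i => c i + e i) => n.
by rewrite cE eE -big_split; apply: eq_bigr => i _; rewrite mulrDl.
Qed.

Lemma binomial_sumZ D a u : binomial_sum D u -> binomial_sum D (fun n => a * u n).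
Proof.
move=> [c cE]; exists (fun i => a * c i) => n.
by rewrite cE mulr_sumr; apply: eq_bigr => i _; rewrite mulrA.
Qed.

Lemma binomial_sum_bin D k : (k <= D)%N ->
  binomial_sum D (fun n => 'C(n + k, k)%:R : R).
Proof.
move=> kD; exists (fun i => (i == k)%:R) => n.
have kD' : (k < D.+1)%N by [].
rewrite (bigD1 (Ordinal kD')) //= eqxx mul1r big1 ?addr0// => i ik.
by case: eqP => [ik'|]; rewrite ?mul0r//; case/eqP: ik; exact: val_inj.
Qed.

Lemma binomial_sum_sum (I : Type) (r : seq I) (P : pred I) D (u : I -> nat -> R) :
  (forall i, P i -> binomial_sum D (u i)) ->
  binomial_sum D (fun n => \sum_(i <- r | P i) u i n).
Proof.
move=> uD; elim: r => [|i r IH].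
  exists (fun=> 0) => n; rewrite big_nil big1// => i _; by rewrite mul0r.
apply: (@eq_binomial_sum _ (fun n => (if P i then u i n else 0) +
  \sum_(j <- r | P j) u j n)) => [n|].
  by rewrite big_cons; case: ifP; rewrite ?add0r.
case Pi: (P i); first exact: binomial_sumD (uD _ Pi) IH.
by apply: eq_binomial_sum IH => n; rewrite add0r.
Qed.

(** The generating functions are polynomials in 1 / (1 - x) of degrees [D.+1] and
    [E.+1], and they are multiplied. *)
Lemma binomial_sum_convolution D E u v : binomial_sum D u -> binomial_sum E v ->
  binomial_sum (D + E).+1 (fun n => \sum_(j < n.+1) u j * v (n - j)%N).
Proof.
move=> [c cE] [e eE].
apply: (@eq_binomial_sum _ (fun n => \sum_(i < D.+1) \sum_(k < E.+1)
   (c i * e k) * 'C(n + (i + k).+1, (i + k).+1)%:R)) => [n|].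
  under [RHS]eq_bigr => j _.
    rewrite cE eE mulr_suml.
    under eq_bigr do rewrite mulr_sumr.
    over.
  rewrite [RHS]exchange_big /=; apply: eq_bigr => i _.
  rewrite [RHS]exchange_big /=; apply: eq_bigr => k _.
  rewrite -sum_binomial_convolution natr_sum mulr_sumr.
  by apply: eq_bigr => j _; rewrite natrM; ring.
apply: binomial_sum_sum => i _; apply: binomial_sum_sum => k _.
by apply: binomial_sumZ; apply: binomial_sum_bin; have := ltn_ord i; have := ltn_ord k; lia.
Qed.

Lemma mul_bin_shift n i :
  (n * 'C(n + i, i) + i.+1 * 'C(n + i, i) = i.+1 * 'C(n + i.+1, i.+1))%N.
Proof. by rewrite -mulnDl addnS -mul_bin_diag; congr (_ * _)%N. Qed.

Lemma binomial_sumMn D u : binomial_sum D u ->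
  binomial_sum D.+1 (fun n => n%:R * u n).
Proof.
move=> [c cE]; apply: (@eq_binomial_sum _ (fun n => \sum_(i < D.+1)
   (c i * i.+1%:R * 'C(n + i.+1, i.+1)%:R + - (c i * i.+1%:R) * 'C(n + i, i)%:R))).
  move=> n; rewrite cE mulr_sumr; apply: eq_bigr => i _.
  rewrite mulNr -!mulrA -mulrBr -!natrM -mul_bin_shift natrD addrK natrM.
  by rewrite mulrCA.
apply: binomial_sum_sum => i _; apply: binomial_sumD; apply: binomial_sumZ;
  by apply: binomial_sum_bin; have := ltn_ord i; lia.
Qed.

Lemma binomial_sum_exp p : binomial_sum p (fun n => n%:R ^+ p).
Proof.
elim: p => [|p IH].
  by exists (fun=> 1) => n; rewrite big_ord1 bin0 mul1r expr0.
by apply: eq_binomial_sum (binomial_sumMn IH) => n; rewrite exprS.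
Qed.

Lemma cvg_invn : (fun n : nat => n%:R^-1 : R) @ \oo --> (0 : R).
Proof.
by rewrite -cvg_shiftS; exact: cvg_harmonic.
Qed.

Lemma cvg_bin i :
  (fun n : nat => 'C(n + i, i)%:R / n%:R ^+ i : R) @ \oo --> (i`!%:R^-1 : R).
Proof.
elim: i => [|i IH].
  have -> : (fun n : nat => 'C(n + 0, 0)%:R / n%:R ^+ 0 : R) = fun=> 1.
    by apply/funext => n; rewrite bin0 expr0 divr1.
  by rewrite fact0 invr1; exact: cvg_cst.
have : (fun n : nat => 'C(n + i, i)%:R / n%:R ^+ i * ((1 + i.+1%:R * n%:R^-1) / i.+1%:R)) @ \oo
    --> (i`!%:R^-1 * ((1 + i.+1%:R * 0) / i.+1%:R) : R).
  apply: cvgM => //; apply: cvgMl; apply: cvgD; first exact: cvg_cst.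
  by apply: cvgMr; exact: cvg_invn.
rewrite mulr0 addr0 mul1r -invfM -natrM mulnC -factS.
apply: cvg_trans; apply: near_eq_cvg; near=> n.
have n0 : n%:R != 0 :> R by rewrite pnatr_eq0 -lt0n; near: n; exists 1%N.
have := mul_bin_shift n i => /(congr1 (fun k => k%:R : R)).
rewrite natrD !natrM -mulrDl => E.
have i0 : i.+1%:R != 0 :> R by rewrite pnatr_eq0.
have -> : 'C(n + i.+1, i.+1)%:R = (n%:R + i.+1%:R) * 'C(n + i, i)%:R / i.+1%:R :> R.
  by rewrite E mulrC mulKf.
by rewrite exprS; field; rewrite expf_neq0 n0 ?nat1r.
Unshelve. all: end_near. Qed.

Lemma binomial_sum_cvg D u : binomial_sum D u ->
  cvg ((fun n : nat => u n / n%:R ^+ D) @ \oo).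
Proof.
move=> [c cE]; apply: (@cvgP _ _ (\sum_(i < D.+1) c i * (i`!%:R^-1 * 0 ^+ (D - i)))).
rewrite (_ : (fun n : nat => _) = (fun n => \sum_(i < D.+1)
   c i * ('C(n + i, i)%:R / n%:R ^+ i * n%:R^-1 ^+ (D - i)))); last first.
  apply/funext => n; rewrite cE mulr_suml; apply: eq_bigr => i _.
  rewrite -!mulrA; congr (_ * (_ * _)).
  by rewrite -!exprVn -exprD subnKC// -ltnS ltn_ord.
apply: cvg_big => [|i _]; first exact: add_continuous.
apply: cvgMr; apply: cvgM; first exact: cvg_bin.
elim: (D - i)%N => [|k IH]; first exact: cvg_cst.
under eq_fun do rewrite exprS.
by rewrite exprS; apply: cvgM => //; exact: cvg_invn.
Qed.

End binomial_sums.

(** * Moments of the ratio over compositions *)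

Section moments.
Variable R : realType.

Definition sum_squares (s : seq nat) : nat := sumn [seq (k ^ 2)%N | k <- s].

(** Splitting off the first part [j], the p-th power of [j ^ 2 + sum_squares s]
    expands by the binomial formula into a sum of convolutions of powers of [j]
    with moments of order at most [p] for one part less. *)
Lemma moment_binomial_sum m p :
  binomial_sum (2 * p + m)
    (fun n => \sum_(s <- compositions m.+1 n) (sum_squares s)%:R ^+ p : R).
Proof.
elim: m p => [|m IH] p.
  rewrite addn0; apply: eq_binomial_sum (binomial_sum_exp R _) => n.
  rewrite (_ : compositions 1 n = [:: [:: n]]).
    by rewrite big_seq1 /sum_squares /= addn0 natrX exprM.
  apply: perm_small_eq => //; apply: uniq_perm (compositions_uniq _ _) _ _ => // s.
  rewrite mem_compositions inE; case: s => [|k [|l s]] //=; rewrite ?addn0.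
    by apply/eqP/eqP => [->|[]].
  by apply/esym/eqP => -[].
apply: (@eq_binomial_sum _ _ (fun n => \sum_(i < p.+1) 'C(p, i)%:R *
  \sum_(j < n.+1) (j%:R ^+ (2 * (p - i))) *
    \sum_(s <- compositions m.+1 (n - j)) (sum_squares s)%:R ^+ i)) => [n|].
  rewrite big_compositions.
  under eq_bigr do rewrite mulr_sumr.
  rewrite [LHS]exchange_big /=; apply: eq_bigr => j _.
  under eq_bigr do rewrite mulrA mulr_sumr.
  rewrite [LHS]exchange_big /=; apply: eq_bigr => s _.
  rewrite /sum_squares /= natrD natrX exprDn; apply: eq_bigr => i _.
  by rewrite -[RHS]mulr_natl -exprM mulrA.
apply: binomial_sum_sum => i _; apply: binomial_sumZ.
rewrite (_ : (2 * p + m.+1) = (2 * (p - i) + (2 * i + m)).+1)%N; last first.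
  by have := ltn_ord i; lia.
exact: binomial_sum_convolution (binomial_sum_exp R _) (IH _).
Qed.

Definition square_ratio (s : seq nat) : R := (sum_squares s)%:R / (sumn s)%:R ^+ 2.

Definition mean (S : seq (seq nat)) (g : seq nat -> R) : R :=
  (\sum_(s <- S) g s) / (size S)%:R.

(** Numerator and number of compositions are polynomial in [n], of degrees
    [2 * p + m] and [m]; dividing by [n ^ (2 * p)] makes the degrees equal. *)
Lemma moment_cvg m p :
  cvg ((fun n => mean (compositions m.+1 n) (fun s => square_ratio s ^+ p)) @ \oo).
Proof.
have /binomial_sum_cvg/cvg_ex[l hl] := moment_binomial_sum m p.
apply: (@cvgP _ _ (l * m`!%:R^-1^-1)).
have f0 : m`!%:R^-1 != 0 :> R by rewrite invr_eq0 pnatr_eq0 -lt0n fact_gt0.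
have H : (fun n => (\sum_(s <- compositions m.+1 n) (sum_squares s)%:R ^+ p) / n%:R ^+ (2 * p + m) *
    ('C(n + m, m)%:R / n%:R ^+ m)^-1 : R) @ \oo --> l * m`!%:R^-1^-1.
  exact: cvgM hl (cvgV f0 (@cvg_bin R m)).
apply: cvg_trans H; apply: near_eq_cvg; near=> n.
have n0 : n%:R != 0 :> R by rewrite pnatr_eq0 -lt0n; near: n; exists 1%N.
rewrite /mean size_compositions /=.
have -> : \sum_(s <- compositions m.+1 n) square_ratio s ^+ p =
    (\sum_(s <- compositions m.+1 n) (sum_squares s)%:R ^+ p) / n%:R ^+ (2 * p) :> R.
  rewrite mulr_suml !big_seq; apply: eq_bigr => s.
  rewrite mem_compositions => /andP[_ /eqP sn].
  by rewrite /square_ratio sn exprMn exprVn exprM.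
have C0 : 'C(n + m, m)%:R != 0 :> R by rewrite pnatr_eq0 -lt0n bin_gt0 leq_addl.
by rewrite exprD; field; rewrite C0 !expf_neq0.
Unshelve. all: end_near. Qed.

End moments.

(** * Uniform approximation by polynomials *)

Section uniform_approximation.
Variable R : realType.
Implicit Types (f : R -> R) (g h : nat -> R) (x e : R).

(** Heine's theorem. Only [x] is confined to the segment: [y] may leave it. *)
Lemma continuous_uniform_segment f a b e : continuous f -> 0 < e ->
  exists2 d : R, 0 < d & forall x y, x \in `[a, b] -> `|x - y| < d -> `|f x - f y| <= e.
Proof.
move=> cf e0.
have /compact_near_coveringP := @segment_compact R a b.
move=> /(_ _ (0 : R)^'+ (fun d x => forall y, `|x - y| < d -> `|f x - f y| <= e)).
case.
  move=> x _.
  have /cvgrPdist_le/(_ (e / 2)) := cf x.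
  rewrite divr_gt0// => /(_ isT)/nbhs_ballP[r /= r0 rf].
  exists (ball x (r / 2), [set d : R | d < r / 2]) => /=.
    split; first by apply: nbhsx_ballx; rewrite divr_gt0.
    by apply: nbhs_right_lt; rewrite divr_gt0.
  move=> [z d] /= [xz dr] y zy.
  have /rf/= fz : ball x r z by apply: le_ball xz; lra.
  have /rf/= fy : ball x r y.
    rewrite /ball/= (_ : x - y = (x - z) + (z - y)); last by ring.
    by apply: le_lt_trans (ler_normD _ _) _; rewrite /ball/= in xz; lra.
  rewrite (_ : f z - f y = (f x - f y) - (f x - f z)); last by ring.
  by apply: le_trans (ler_normB _ _) _; lra.
move=> d /= d0 H; exists (d / 2); first by rewrite divr_gt0.
move=> x y xab xy; apply: (H (d / 2)) => //=; rewrite ?divr_gt0//.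
by rewrite sub0r normrN ger0_norm; lra.
Qed.

(** The Bernstein polynomial, that is the mean of [g] at a binomial variable with
    parameters [n] and 'X, by conditioning on the first trial. In this form its
    properties are inductions that involve no binomial coefficient. *)
Fixpoint bernstein n g : {poly R} :=
  if n is n'.+1 then 'X * bernstein n' (g \o succn) + (1 - 'X) * bernstein n' g
  else (g 0%N)%:P.

Lemma bernsteinS n g x : (bernstein n.+1 g).[x] =
  x * (bernstein n (g \o succn)).[x] + (1 - x) * (bernstein n g).[x].
Proof. by rewrite /= !hornerE. Qed.

Lemma bernstein_lin n a g h x :
  (bernstein n (fun k => a * g k + h k)).[x] =
  a * (bernstein n g).[x] + (bernstein n h).[x].
Proof.
elim: n g h => [|n IH] g h; first by rewrite /= !hornerE.
rewrite !bernsteinS IH (_ : _ \o succn = fun k => a * (g \o succn) k + (h \o succn) k) //.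
by rewrite IH; ring.
Qed.

Lemma bernstein_cst n c x : (bernstein n (fun=> c)).[x] = c.
Proof.
elim: n => [|n IH]; first by rewrite /= !hornerE.
by rewrite bernsteinS (_ : _ \o succn = fun=> c)// IH; ring.
Qed.

Lemma bernstein_le n g h x : 0 <= x <= 1 -> (forall k, (k <= n)%N -> g k <= h k) ->
  (bernstein n g).[x] <= (bernstein n h).[x].
Proof.
move=> /andP[x0 x1]; elim: n g h => [|n IH] g h gh.
  by rewrite /= !hornerE; exact: gh.
rewrite !bernsteinS; apply: lerD; apply: ler_wpM2l; rewrite ?subr_ge0//.
  by apply: IH => k kn; exact: gh.
by apply: IH => k kn; apply: gh; apply: leqW.
Qed.

Lemma bernstein_norm n g x : 0 <= x <= 1 ->
  `|(bernstein n g).[x]| <= (bernstein n (fun k => `|g k|)).[x].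
Proof.
move=> x01; rewrite ler_norml; apply/andP; split; last first.
  by apply: bernstein_le => // k _; exact: ler_norm.
have := @bernstein_lin n (-1) (fun k => `|g k|) (fun=> 0) x.
rewrite bernstein_cst addr0 mulN1r => <-; apply: bernstein_le => // k _.
by rewrite addr0 mulN1r; rewrite lerNl -normrN ler_norm.
Qed.

(** Second moment about [c] of a binomial variable: variance plus squared bias. *)
Lemma bernstein_variance n c x :
  (bernstein n (fun k => (k%:R - c) ^+ 2)).[x] = n%:R * (x * (1 - x)) + (n%:R * x - c) ^+ 2.
Proof.
elim: n c => [|n IH] c; first by rewrite /= !hornerE; ring.
rewrite bernsteinS IH (_ : _ \o succn = fun k => (k%:R - (c - 1)) ^+ 2); last first.
  by apply/funext => k /=; rewrite -natr1; ring.
by rewrite IH -natr1; ring.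
Qed.

(** Bernstein's proof: Chebyshev's inequality in the form of the pointwise bound
    [`|f x - f (k / n)| <= e / 2 + 2 * M * ((x - k / n) / d) ^+ 2], where [d] is a
    modulus of continuity for [e / 2] and [M] bounds [f]; averaging over [k]
    turns the square into a variance, of order [1 / n]. *)
Lemma weierstrass f e : continuous f -> 0 < e ->
  exists q : {poly R}, forall x, 0 <= x <= 1 -> `|f x - q.[x]| <= e.
Proof.
move=> cf e0.
have e20 : 0 < e / 2 by rewrite divr_gt0.
have [d d0 fd] := continuous_uniform_segment 0 1 cf e20.
have [M M0 fM] : exists2 M : R, 0 <= M & forall x, 0 <= x <= 1 -> `|f x| <= M.
  have : compact (f @` `[0, 1]).
    apply: continuous_compact; last exact: segment_compact.
    exact: continuous_subspaceT.
  move=> /compact_bounded/ex_strict_bound_gt0[M M0 fM]; exists M; first exact: ltW.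
  by move=> x x01; apply/ltW/fM; exists x => //=; rewrite in_itv.
(* This n makes the variance term 2 * M / (d ^+ 2 * n) at most e / 2. *)
pose n := (Num.truncn (4 * M / (e * d ^+ 2))).+1.
have n0 : 0 < n%:R :> R by rewrite ltr0n.
exists (bernstein n (fun k => f (k%:R / n%:R))) => x x01.
have -> : f x - (bernstein n (fun k => f (k%:R / n%:R))).[x] =
    (bernstein n (fun k => (-1) * f (k%:R / n%:R) + f x)).[x].
  by rewrite bernstein_lin bernstein_cst mulN1r addrC.
apply: le_trans (bernstein_norm _ _ x01) _.
pose c := 2 * M / (d ^+ 2 * n%:R ^+ 2).
apply: (@le_trans _ _ (bernstein n (fun k => c * (k%:R - n%:R * x) ^+ 2 + e / 2)).[x]).
  apply: bernstein_le => // k kn.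
  have kn01 : 0 <= (k%:R / n%:R : R) <= 1.
    by rewrite divr_ge0 ?ler0n//= ler_pdivrMr// mul1r ler_nat.
  have cE : c * (k%:R - n%:R * x) ^+ 2 = 2 * M * ((x - k%:R / n%:R) / d) ^+ 2.
    by rewrite /c; field; rewrite ?gt_eqF//.
  rewrite mulN1r addrC; have [xd|xd] := ltP `|x - k%:R / n%:R| d.
    apply: le_trans (fd _ _ _ xd) _; first by rewrite in_itv.
    by rewrite lerDr cE mulr_ge0 ?sqr_ge0// mulr_ge0.
  apply: (@le_trans _ _ (2 * M)).
    apply: le_trans (ler_normB _ _) _.
    by have := fM _ x01; have := fM _ kn01; lra.
  rewrite cE -[leLHS]addr0 lerD ?(ltW e20)// ler_peMr ?mulr_ge0//.
  rewrite -real_normK ?num_real// normrM normfV (gtr0_norm d0).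
  by rewrite expr_ge1// ?divr_ge0 ?(ltW d0)// ler_pdivlMr// mul1r.
rewrite bernstein_lin bernstein_cst bernstein_variance subrr expr0n addr0.
suff : c * (n%:R * (x * (1 - x))) <= e / 2 by lra.
have xx : x * (1 - x) <= 1 by nra.
have -> : c * (n%:R * (x * (1 - x))) = 2 * M / (d ^+ 2 * n%:R) * (x * (1 - x)).
  by rewrite /c; field; rewrite ?gt_eqF.
apply: (@le_trans _ _ (2 * M / (d ^+ 2 * n%:R))).
  by apply: ler_piMr => //; rewrite divr_ge0 ?mulr_ge0 ?sqr_ge0// ltW.
rewrite ler_pdivrMr ?mulr_gt0 ?exprn_gt0//.
have : 4 * M / (e * d ^+ 2) <= n%:R by apply/ltW/truncnS_gt.
rewrite ler_pdivrMr ?mulr_gt0 ?exprn_gt0//; lra.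
Qed.

End uniform_approximation.

(** * Averages over compositions converge *)

Section mean_cvg.
Variable R : realType.

Lemma mean_close (S : seq (seq nat)) (g h : seq nat -> R) (e : R) : 0 <= e ->
  (forall s, s \in S -> `|g s - h s| <= e) -> `|mean S g - mean S h| <= e.
Proof.
move=> e0 gh; rewrite /mean -mulrBl -sumrB normrM normfV normr_nat.
have [->|S0] := eqVneq (size S) 0%N; first by rewrite invr0 mulr0.
rewrite ler_pdivrMr ?ltr0n ?lt0n//.
apply: le_trans (ler_norm_sum _ _ _) _.
rewrite mulr_natr -sum1_size -sumrMnr /= big_seq [leRHS]big_seq.
by apply: ler_sum => s /gh.
Qed.

Lemma square_ratio01 (s : seq nat) : 0 <= square_ratio R s <= 1.
Proof.
rewrite /square_ratio divr_ge0 ?exprn_ge0 ?ler0n//=.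
have H : (sum_squares s <= sumn s ^ 2)%N.
  rewrite /sum_squares; elim: s => //= k s IH; nia.
have [->|s0] := eqVneq (sumn s) 0%N; first by rewrite expr0n invr0 mulr0.
by rewrite ler_pdivrMr ?mul1r -?natrX ?ler_nat// ltr0n expn_gt0 lt0n s0.
Qed.

Lemma mean_poly_cvg (q : {poly R}) m :
  cvg ((fun n => mean (compositions m.+1 n) (fun s => q.[square_ratio R s])) @ \oo).
Proof.
apply: (@cvgP _ _ (\sum_(i < size q) q`_i *
  limn (fun n => mean (compositions m.+1 n) (fun s => square_ratio R s ^+ i)))).
rewrite (_ : (fun n => _) = fun n => \sum_(i < size q) q`_i *
  mean (compositions m.+1 n) (fun s => square_ratio R s ^+ i)); last first.
  apply/funext => n; rewrite /mean; under eq_bigr do rewrite horner_coef.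
  rewrite exchange_big mulr_suml; apply: eq_bigr => i _ /=.
  by rewrite -mulr_sumr mulrA.
apply: cvg_big => [|i _]; first exact: add_continuous.
by apply: cvgMr; exact: moment_cvg.
Qed.

(** The averages form a Cauchy sequence: up to a uniform error they are those of a
    polynomial, which converge by the moments. The value of the limit is
    identified separately, by [integral_variable_ratio]. *)
Lemma mean_cvg (f : R -> R) m : continuous f ->
  cvg ((fun n => mean (compositions m.+1 n) (fun s => f (square_ratio R s))) @ \oo).
Proof.
move=> cf; apply/cauchy_cvgP/cauchy_exP => e e0.
have e20 : 0 < e / 2 by rewrite divr_gt0.
have [q fq] := weierstrass cf e20.
exists (limn (fun n => mean (compositions m.+1 n) (fun s => q.[square_ratio R s]))).
have /cvgrPdist_lt/(_ _ e20) := @mean_poly_cvg q m.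
apply: filterS => n /= H; rewrite /ball/=.
set l := limn _ in H *.
rewrite (_ : l - _ = (l - mean (compositions m.+1 n) (fun s => q.[square_ratio R s])) +
  (mean (compositions m.+1 n) (fun s => q.[square_ratio R s]) -
   mean (compositions m.+1 n) (fun s => f (square_ratio R s)))); last by ring.
apply: le_lt_trans (ler_normD _ _) _.
rewrite [ltRHS](splitr e); apply: ltr_leD => //.
apply: mean_close => [|s _]; first exact: ltW.
by rewrite distrC; apply: fq; exact: square_ratio01.
Qed.

End mean_cvg.

(** * Integration of bounded functions *)

Lemma bounded_probability_integrable d (T : measurableType d) (R : realType)
    (P : probability T R) (g : T -> R) (M : R) :
  measurable_fun [set: T] g -> (forall w, `|g w| <= M) ->
  P.-integrable [set: T] (EFin \o g).
Proof.
move=> mg gM; apply: measurable_bounded_integrable => //.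
  by rewrite ltey_eq fin_num_measure.
exists M; split; first exact: num_real.
by move=> x Mx w _ /=; apply: le_trans (gM _) (ltW Mx).
Qed.

Lemma bounded_convergence d (T : measurableType d) (R : realType)
    (P : probability T R) (M : R) (F : nat -> T -> R) (G : T -> R) :
  (forall j, measurable_fun [set: T] (F j)) -> measurable_fun [set: T] G ->
  (forall j w, `|F j w| <= M) -> {ae P, forall w, (fun j => F j w) @ \oo --> G w} ->
  (fun j => \int[P]_w (F j w)%:E)%E @ \oo --> (\int[P]_w (G w)%:E)%E.
Proof.
move=> mF mG FM FG.
have [] // := @dominated_convergence _ T R P setT measurableT
  (fun j w => (F j w)%:E) (fun w => (G w)%:E) (EFin \o cst M).
- by move=> j; exact/measurable_EFinP.
- exact/measurable_EFinP.
- by apply: filterS FG => w FGw _; apply: cvg_EFin => //; exact: nearW.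
- exact: finite_measure_integrable_cst.
- by apply: nearW => w j _; rewrite /= lee_fin.
Qed.

Lemma integral_partition d (T : measurableType d) (R : realType)
    (mu : {finite_measure set T -> \bar R}) (I : eqType) (F : I -> set T)
    (s : seq I) (phi : I -> R) (f : T -> R) :
  (forall i, measurable (F i)) -> uniq s -> trivIset [set` s] F ->
  measurable_fun [set: T] f -> (forall i w, F i w -> f w = phi i) ->
  (\int[mu]_(w in \big[setU/set0]_(i <- s) F i) (f w)%:E =
   \sum_(i <- s) (phi i)%:E * mu (F i))%E.
Proof.
move=> mF us tF mf fphi.
rewrite integral_bigsetU_EFin//; last exact/measurable_EFinP/measurable_funTS.
apply: eq_bigr => i _; rewrite -integral_cst//.
by apply: eq_integral => w /set_mem /fphi ->.
Qed.

(** * The exponential law on the cells of a lattice *)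

Section exponential.
Variable R : realType.
Notation mu := (@lebesgue_measure R).

Definition exponential_density (x : R) : R := expR (- x) * \1_`[0, +oo[ x.

Lemma integral_exponential_density (A : set R) :
  (\int[mu]_(x in A) (exponential_density x)%:E =
   \int[mu]_(x in A `&` `[0%R, +oo[) (expR (- x))%:E)%E.
Proof.
rewrite integral_mkcondr; apply: eq_integral => x _.
rewrite /patch /exponential_density indicE.
by case: (x \in _); rewrite ?mulr1 ?mulr0.
Qed.

Lemma integral_expRN (a b : R) : a < b ->
  (\int[mu]_(x in `[a, b[) (expR (- x))%:E = (expR (- a) - expR (- b))%:E)%E.
Proof.
move=> ab.
have ce : continuous (fun z : R => expR (- z)).
  by move=> z; apply: continuous_comp; [exact: opp_continuous|exact: continuous_expR].
rewrite integral_itv_bndo_bndc; last first.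
  by apply/measurable_EFinP/measurable_funTS; exact: continuous_measurable_fun.
rewrite (@continuous_FTC2 _ _ (fun x => - expR (- x)))//.
- by rewrite -EFinB opprK addrC.
- exact: continuous_subspaceT.
- split.
  + by move=> z _; exact: ex_derive.
  + by apply/cvg_at_right_filter; apply: cvgN; exact: ce.
  + by apply/cvg_at_left_filter; apply: cvgN; exact: ce.
- move=> z _; rewrite derive1_comp// derive1N// derive1_id mulN1r derive1_comp// derive1E.
  have /funeqP -> := @derive_expR R.
  by rewrite derive1N// derive1_id mulrN1 opprK.
Qed.

(** The cell of index 0 also contains the negative reals, which carry no
    exponential mass; the others are intervals of length [1 / r]. *)
Definition cell (r : R) (k : nat) : set R := [set x | Num.truncn (x * r) = k].

Lemma measurable_cell r k : 0 < r -> measurable (cell r k).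
Proof.
move=> r0.
have mlt n : measurable [set x : R | (Num.truncn (x * r) < n)%N].
  case: n => [|n].
    by rewrite (_ : [set _ | _] = set0)//; apply/seteqP; split.
  rewrite (_ : [set _ | _] = `]-oo, n.+1%:R / r[%classic); first exact: measurable_itv.
  by apply/seteqP; split => x /=; rewrite ltnS truncn_le_nat in_itv /= ltr_pdivlMr.
rewrite (_ : cell r k = [set x : R | (Num.truncn (x * r) < k.+1)%N] `\`
  [set x : R | (Num.truncn (x * r) < k)%N]).
  exact: measurableD.
apply/seteqP; split => x /=; rewrite /cell /=; first by move=> ->; split; rewrite ?ltnn.
by move=> [+ /negP]; rewrite -leqNgt ltnS => a b; apply/eqP; rewrite eqn_leq a.
Qed.

(** The geometric law of the rounded variable: the mass decreases by a constant
    factor from one cell to the next. *)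
Lemma integral_cell r k : 0 < r ->
  (\int[mu]_(x in cell r k) (exponential_density x)%:E =
   (expR (- r^-1) ^+ k * (1 - expR (- r^-1)))%:E)%E.
Proof.
move=> r0; rewrite integral_exponential_density.
rewrite (_ : cell r k `&` _ = `[k%:R / r, k.+1%:R / r[%classic).
  rewrite integral_expRN ?ltr_pM2r ?invr_gt0 ?ltr_nat//.
  have E n : expR (- (n%:R / r)) = expR (- r^-1) ^+ n by rewrite -expRM_natl mulrN.
  by rewrite !E exprS; congr (_%:E); ring.
apply/seteqP; split => x /=; rewrite /cell /= !in_itv /= ler_pdivrMr// ltr_pdivlMr//.
  by rewrite andbT => -[xk x0]; rewrite -truncn_eq ?xk ?eqxx// mulr_ge0// ltW.
move=> xk; have xr0 : 0 <= x * r by case/andP: xk => + _; apply: le_trans.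
split; first by apply/eqP; rewrite truncn_eq.
by rewrite andbT; move: xr0; rewrite pmulr_lge0.
Qed.

Lemma cvg_truncn_scaled (x : R) : 0 <= x ->
  (fun j : nat => (Num.truncn (x * j.+1%:R))%:R / j.+1%:R : R) @ \oo --> x.
Proof.
move=> x0; apply/cvgrPdist_le => e e0; near=> j.
have j0 : 0 < j.+1%:R :> R by rewrite ltr0n.
have xj : 0 <= x * j.+1%:R by rewrite mulr_ge0.
have /andP[t1 t2] := truncn_itv xj.
have -> : x - (Num.truncn (x * j.+1%:R))%:R / j.+1%:R =
   (x * j.+1%:R - (Num.truncn (x * j.+1%:R))%:R) / j.+1%:R.
  by field; rewrite nat1r pnatr_eq0.
rewrite ger0_norm ?divr_ge0 ?subr_ge0//.
apply: (@le_trans _ _ (j.+1%:R^-1)).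
  rewrite ler_pdivrMr// mulVf ?gt_eqF//; move: t2; rewrite -natr1; lra.
near: j; have : (fun n : nat => n.+1%:R^-1 : R) @ \oo --> (0 : R).
  exact: cvg_harmonic.
move=> /cvgrPdist_le/(_ _ e0); apply: filterS => j.
by rewrite sub0r normrN ger0_norm// invr_ge0.
Unshelve. all: end_near. Qed.

Lemma cvg_truncn_infty (x : R) : 0 < x ->
  (fun j : nat => Num.truncn (x * j.+1%:R)) @ \oo --> \oo.
Proof.
move=> x0; apply/cvgnyPge => M; exists (Num.truncn (M%:R / x)).+1 => // j /= Mj.
rewrite truncn_ge_nat ?mulr_ge0 ?(ltW x0)//.
rewrite mulrC -ler_pdivrMr//; apply: ltW; apply: lt_le_trans (truncnS_gt _) _.
by rewrite ler_nat; apply: leq_trans Mj _.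
Qed.

End exponential.

(** * The limit law through rounding to a lattice *)

Section limit_law.
Context (R : realType) (m : nat) (d : measure_display) (T : measurableType d)
  (P : probability T R) (xi : 'I_m -> {RV P >-> R}).
Hypothesis hindep : mutually_independent P xi.
Hypothesis hdens : forall i, has_density P (xi i) (@exponential_density R).

Lemma ae_positive : {ae P, forall w, forall i, 0 < xi i w}.
Proof.
apply: filter_forall => i; exists (xi i @^-1` `]-oo, 0]); split.
- by rewrite -[_ @^-1` _]setTI; apply: measurable_funP.
- have := hdens i (measurable_itv `]-oo, 0]).
  rewrite /distribution /pushforward => ->.
  rewrite integral_exponential_density (_ : _ `&` _ = [set 0]) ?integral_set1//.
  apply/seteqP; split => x /=; rewrite !in_itv/= ?andbT.
    by move=> [? ?]; apply/eqP; rewrite eq_le; apply/andP.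
  by move=> ->; rewrite !lexx.
- by move=> w /= /negP; rewrite -leNgt in_itv.
Qed.

Definition lattice_point (j : nat) (w : T) : seq nat :=
  [seq Num.truncn (xi i w * j.+1%:R) | i <- enum 'I_m].

Lemma big_lattice_point j w (g : nat -> nat) :
  (\sum_(k <- lattice_point j w) g k =
   \sum_(i < m) g (Num.truncn (xi i w * j.+1%:R)))%N.
Proof. by rewrite /lattice_point big_map big_enum. Qed.

Lemma lattice_pointP j w s : size s = m ->
  lattice_point j w = s <-> forall i : 'I_m, Num.truncn (xi i w * j.+1%:R) = nth 0%N s i.
Proof.
move=> sm; split=> [<- i|E].
  by rewrite (nth_map i) ?size_enum_ord// nth_ord_enum.
apply: (@eq_from_nth _ 0%N); rewrite size_map size_enum_ord ?sm// => i im.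
rewrite (nth_map (Ordinal im)) ?size_enum_ord// E.
by congr (nth _ _ _); rewrite nth_enum_ord.
Qed.

Lemma lattice_point_preimage j s : size s = m ->
  lattice_point j @^-1` [set s] =
  \bigcap_(i in [set` [set: 'I_m]%SET]) (xi i @^-1` cell j.+1%:R (nth 0%N s i)).
Proof.
move=> sm; apply/seteqP; split => w /=.
  by move=> /(lattice_pointP _ _ sm) E i _; rewrite /cell /= E.
by move=> E; apply/(lattice_pointP _ _ sm) => i; apply: (E i); rewrite /= inE.
Qed.

Lemma measurable_lattice_point j s : measurable (lattice_point j @^-1` [set s]).
Proof.
have [sm|sm] := eqVneq (size s) m; last first.
  rewrite (_ : _ @^-1` _ = set0)//; apply/seteqP; split => // w /= E.
  by move: sm; rewrite -E size_map size_enum_ord eqxx.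
rewrite lattice_point_preimage//; apply: fin_bigcap_measurable => // i _.
rewrite -[_ @^-1` _]setTI.
by apply: measurable_funP => //; apply: measurable_cell; rewrite ltr0n.
Qed.

(** By independence the probability depends on the composition only through its
    sum: given the sum, the rounded vector is a uniform composition. *)
Lemma prob_lattice_point j s : size s = m ->
  P (lattice_point j @^-1` [set s]) =
  (expR (- j.+1%:R^-1) ^+ sumn s * (1 - expR (- j.+1%:R^-1)) ^+ m)%:E.
Proof.
move=> sm; rewrite lattice_point_preimage//.
have j0 : 0 < j.+1%:R :> R by rewrite ltr0n.
rewrite (hindep _ (A := fun i : 'I_m => cell j.+1%:R (nth 0%N s i))); last first.
  by move=> i; exact: measurable_cell.
rewrite (eq_bigr (fun i : 'I_m => (expR (- j.+1%:R^-1) ^+ nth 0%N s i *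
    (1 - expR (- j.+1%:R^-1)))%:E)); last first.
  by move=> i _; rewrite -integral_cell// -(hdens i (measurable_cell _ j0)).
rewrite prodEFin big_split /= prodr_const cardsT card_ord; congr (_ * _)%:E.
rewrite -expr_sum; congr (_ ^+ _).
under eq_bigl do rewrite inE.
by rewrite sumnE (big_nth 0%N) sm big_mkord.
Qed.

Lemma integral_level (phi : seq nat -> R) (f : T -> R) j n :
  measurable_fun [set: T] f -> (forall w, f w = phi (lattice_point j w)) ->
  (\int[P]_(w in [set w | sumn (lattice_point j w) = n]) (f w)%:E =
   ((\sum_(s <- compositions m n) phi s) *
    (expR (- j.+1%:R^-1) ^+ n * (1 - expR (- j.+1%:R^-1)) ^+ m))%:E)%E.
Proof.
move=> mf fphi.
rewrite (_ : [set w | _] =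
  \big[setU/set0]_(s <- compositions m n) (lattice_point j @^-1` [set s])); last first.
  rewrite -bigcup_seq; apply/seteqP; split => w /=.
    by move=> E; exists (lattice_point j w) => //=;
    rewrite mem_compositions size_map size_enum_ord E !eqxx.
  by move=> [s /=]; rewrite mem_compositions => /andP[_ /eqP <-] ->.
rewrite (@integral_partition _ _ _ _ _ _ _ phi)//.
- rewrite mulr_suml -sumEFin !big_seq; apply: eq_bigr => s.
  rewrite mem_compositions => /andP[/eqP sm /eqP <-].
  by rewrite EFinM; congr (_ * _)%E; exact: prob_lattice_point.
- by move=> s; exact: measurable_lattice_point.
- exact: compositions_uniq.
- by move=> s t _ _ [w [/= <- <-]].
- by move=> s w /= <-.
Qed.

(** The lattice points form a countable set, so every function of them is a
    countable combination of indicators. *)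
Lemma measurable_lattice_fun j (phi : seq nat -> R) :
  measurable_fun [set: T] (phi \o lattice_point j).
Proof.
move=> _ Y _; rewrite setTI.
rewrite (_ : _ @^-1` Y = \bigcup_s
    (if phi s \in Y then lattice_point j @^-1` [set s] else set0)); last first.
  apply/seteqP; split => w /=.
    by move=> Yw; exists (lattice_point j w); rewrite // mem_set.
  by move=> [s _]; case: ifPn => // /set_mem Ys /= ->.
apply: countable_bigcupT_measurable => [|s]; first exact: countableP.
by case: ifP => // _; exact: measurable_lattice_point.
Qed.

(** Given its sum [n], the lattice point is uniform on the compositions of [n], so
    that [phi] and [psi] have the same conditional means. *)
Lemma integral_lattice_fun j (phi psi : seq nat -> R) M :
  (forall s, `|phi s| <= M) -> (forall s, `|psi s| <= M) ->
  (forall n, \sum_(s <- compositions m n) phi s = \sum_(s <- compositions m n) psi s) ->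
  (\int[P]_w (phi (lattice_point j w))%:E = \int[P]_w (psi (lattice_point j w))%:E)%E.
Proof.
move=> phiM psiM E.
pose B n := [set w | sumn (lattice_point j w) = n].
have BT : \bigcup_n B n = [set: T].
  by apply/seteqP; split => w //= _; exists (sumn (lattice_point j w)).
have mB n : measurable (B n).
  have := @measurable_lattice_fun j (fun s => (sumn s)%:R) measurableT [set n%:R].
  move=> /(_ (measurable_set1 _)); rewrite setTI.
  congr measurable; apply/seteqP; split => w /=; last by rewrite /B /= => ->.
  by move=> /eqP; rewrite eqr_nat => /eqP.
have tB : trivIset setT B by move=> k l _ _ [w [<- <-]].
rewrite -BT !integral_bigcup//; last 2 first.
- rewrite BT; apply: (@bounded_probability_integrable _ _ _ P (psi \o lattice_point j) M).
    exact: measurable_lattice_fun.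
  by move=> w; exact: psiM.
- rewrite BT; apply: (@bounded_probability_integrable _ _ _ P (phi \o lattice_point j) M).
    exact: measurable_lattice_fun.
  by move=> w; exact: phiM.
apply: eq_eseriesr => n _.
rewrite (@integral_level phi _ j n (measurable_lattice_fun j _))//.
by rewrite (@integral_level psi _ j n (measurable_lattice_fun j _))// E.
Qed.

Definition variable_ratio (w : T) : R := (\sum_(i < m) xi i w ^+ 2) / (\sum_(i < m) xi i w) ^+ 2.

(** The ratio is homogeneous of degree 0, so the integer coordinates may be
    rescaled to approximate the variables themselves. *)
Lemma square_ratio_lattice_point j w : square_ratio R (lattice_point j w) =
  (\sum_(i < m) ((Num.truncn (xi i w * j.+1%:R))%:R / j.+1%:R) ^+ 2) /
  (\sum_(i < m) ((Num.truncn (xi i w * j.+1%:R))%:R / j.+1%:R)) ^+ 2.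
Proof.
rewrite /square_ratio /sum_squares !sumnE big_map !big_lattice_point.
rewrite -mulr_suml; under [in RHS]eq_bigr do rewrite exprMn.
rewrite -mulr_suml exprMn -mulf_div divff ?mulr1 ?expf_neq0 ?invr_eq0 ?pnatr_eq0//.
rewrite !natr_sum; congr (_ / _).
by apply: eq_bigr => i _; rewrite natrX.
Qed.

Lemma square_ratio_lattice_cvg w : (0 < m)%N -> (forall i, 0 < xi i w) ->
  (fun j => square_ratio R (lattice_point j w)) @ \oo --> variable_ratio w.
Proof.
move=> m0 xi0; under eq_fun do rewrite square_ratio_lattice_point.
have S0 : \sum_(i < m) xi i w != 0.
  rewrite gt_eqF// (bigD1 (Ordinal m0))//= ltr_pwDl//.
  by apply: sumr_ge0 => i _; exact: ltW.
have c i : (fun j : nat => (Num.truncn (xi i w * j.+1%:R))%:R / j.+1%:R) @ \oo --> xi i w.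
  by apply: cvg_truncn_scaled; exact: ltW.
apply: cvgM.
  apply: cvg_big => [|i _]; first exact: add_continuous.
  under eq_fun do rewrite expr2.
  by rewrite expr2; apply: cvgM; exact: c.
apply: cvgV; first by rewrite expf_neq0.
have cs : (fun j : nat => \sum_(i < m) (Num.truncn (xi i w * j.+1%:R))%:R / j.+1%:R) @ \oo
    --> \sum_(i < m) xi i w.
  by apply: cvg_big => [|i _]; [exact: add_continuous|exact: c].
by under eq_fun do rewrite expr2; rewrite expr2; apply: cvgM; exact: cs.
Qed.

Lemma sumn_lattice_cvg w : (0 < m)%N -> (forall i, 0 < xi i w) ->
  (fun j => sumn (lattice_point j w)) @ \oo --> \oo.
Proof.
move=> m0 xi0; apply/cvgnyPge => M.
have /cvgnyPge/(_ M) := cvg_truncn_infty (xi0 (Ordinal m0)).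
apply: filterS => j Mj; apply: leq_trans Mj _.
by rewrite sumnE (big_lattice_point _ _ id) (bigD1 (Ordinal m0)) //= leq_addr.
Qed.

Lemma measurable_variable_ratio : measurable_fun [set: T] variable_ratio.
Proof.
rewrite (_ : variable_ratio = limit_stat 2 xi); first exact: measurable_limit_stat.
by apply/funext => w; rewrite /limit_stat divff// mul1r.
Qed.

(** Let [u n] be the average of [f] at the ratio over the compositions of [n]. The
    mean of [f] at the ratio of the rounded variables equals the mean of [u] at
    their sum. As the mesh tends to 0 the former tends to the left side, and the
    latter to [L] because the sum tends to infinity. *)
Lemma integral_variable_ratio (f : R -> R) M L : (0 < m)%N -> continuous f ->
  (forall x, `|f x| <= M) ->
  (fun n => mean (compositions m n) (fun s => f (square_ratio R s))) @ \oo --> L ->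
  (\int[P]_w (f (variable_ratio w))%:E = L%:E)%E.
Proof.
move=> m0 cf fM.
set u := (X in X @ \oo --> _) => uL.
have M0 : 0 <= M by apply: le_trans (fM 0).
have uM n : `|u n| <= M.
  have := @mean_close R (compositions m n) (fun s => f (square_ratio R s)) (fun=> 0) M M0.
  rewrite {2}/mean big1// mul0r subr0; apply => s _; rewrite subr0; exact: fM.
have mE j : (\int[P]_w (f (square_ratio R (lattice_point j w)))%:E =
             \int[P]_w (u (sumn (lattice_point j w)))%:E)%E.
  apply: (@integral_lattice_fun j (f \o square_ratio R) (u \o sumn) M) => [s|s|n] /=.
  - exact: fM.
  - exact: uM.
  have -> : \sum_(s <- compositions m n) u (sumn s) = \sum_(s <- compositions m n) u n.
    by rewrite !big_seq; apply: eq_bigr => s; rewrite mem_compositions => /andP[_ /eqP ->].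
  rewrite big_const_seq count_predT iter_addr_0 /u /mean -[RHS]mulr_natr.
  have : (size (compositions m n) != 0)%N.
    by case: (m) m0 => // k _; rewrite size_compositions -lt0n bin_gt0 leq_addl.
  by move=> c0; rewrite divfK// pnatr_eq0.
have H1 : (fun j => \int[P]_w (f (square_ratio R (lattice_point j w)))%:E)%E @ \oo -->
    (\int[P]_w (f (variable_ratio w))%:E)%E.
  apply: (@bounded_convergence _ _ _ _ M) => //.
  - by move=> j; exact: (@measurable_lattice_fun j (f \o square_ratio R)).
  - apply: measurableT_comp measurable_variable_ratio; exact: continuous_measurable_fun.
  - apply: filterS ae_positive => w w0.
    by apply: (cvg_comp _ _ (square_ratio_lattice_cvg m0 w0)); exact: cf.
have H2 : (fun j => \int[P]_w (u (sumn (lattice_point j w)))%:E)%E @ \oo -->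
    (\int[P]_w L%:E)%E.
  apply: (@bounded_convergence _ _ _ _ M) => //.
  - by move=> j; exact: (@measurable_lattice_fun j (u \o sumn)).
  - apply: filterS ae_positive => w w0.
    exact: (cvg_comp _ _ (sumn_lattice_cvg m0 w0) uL).
rewrite -[RHS]mule1 -(@probability_setT _ _ _ P) -integral_cst//.
move: H2; rewrite -(funext mE) => H2.
exact: (cvg_unique _ H1 H2).
Qed.

End limit_law.

(** * From compositions to partitions *)

Definition pad (m : nat) (s : seq nat) : seq nat := s ++ nseq (m - size s) 0%N.

Lemma sumn_pad m s : sumn (pad m s) = sumn s.
Proof. by rewrite sumn_cat sumn_nseq mul0n addn0. Qed.

Lemma pad_compositions m n (k : intpart) : partitions_le n m k -> pad m k \in compositions m n.
Proof.
move=> [kn km]; rewrite mem_compositions sumn_pad kn size_cat size_nseq subnKC//.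
by rewrite !eqxx.
Qed.

Lemma intpart_gt0 (k : intpart) : 0%N \notin (k : seq nat).
Proof. by have /andP[] := valP k. Qed.

Lemma intpart_sorted (k : intpart) : sorted geq k.
Proof. by have /andP[] := valP k. Qed.

Lemma geq_trans : transitive geq.
Proof. by move=> a b c ba ac; exact: leq_trans ac ba. Qed.

Lemma geq_anti : antisymmetric geq.
Proof. by move=> a b; rewrite andbC => /anti_leq. Qed.

Lemma geq_total : total geq.
Proof. by move=> a b; exact: leq_total. Qed.

Lemma pad_inj m : injective (fun k : intpart => pad m k).
Proof.
move=> k l kl; apply/val_inj => /=.
have F (i : intpart) : [seq x <- pad m i | x != 0%N] = i.
  rewrite filter_cat (_ : seq.filter _ (nseq _ _) = [::]) ?cats0; last first.
    by elim: (_ - _)%N.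
  apply/all_filterP/allP => x xi; apply: contraNneq (intpart_gt0 i) => <- //.
by rewrite -(F k) -(F l) kl.
Qed.

Definition strict_parts (m : nat) (k : intpart) := (size k == m) && uniq k.

Lemma generic_pad m (k : intpart) : (size k <= m)%N ->
  generic (pad m k) = strict_parts m k.
Proof.
rewrite leq_eqVlt /strict_parts => /predU1P[<-|km].
  by rewrite /pad subnn cats0 eqxx /generic intpart_gt0 andbT.
rewrite (ltn_eqF km) /= /generic mem_cat mem_nseq eqxx subn_gt0 km.
by rewrite orbT andbF.
Qed.

Definition sort_partition (s : seq nat) : intpart := insubd intpart0 (sort geq s).

Lemma sort_partitionE s : generic s -> sort_partition s = sort geq s :> seq nat.
Proof.
move=> /andP[_ s0]; rewrite [LHS]insubdK// /is_intpart unfold_in.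
by rewrite mem_sort s0 andbT sort_sorted//; exact: geq_total.
Qed.

Lemma sort_partition_perm s (k : intpart) : generic s ->
  perm_eq s k = (k == sort_partition s).
Proof.
move=> gs; apply/idP/eqP => [sk|->]; last by rewrite sort_partitionE// perm_sym perm_sort.
apply/val_inj => /=; rewrite sort_partitionE//.
apply: (sorted_eq geq_trans geq_anti); rewrite ?intpart_sorted//.
  by apply: sort_sorted; exact: geq_total.
by rewrite perm_sym perm_sort.
Qed.

(** [S] stands for the partitions with at most, or with exactly, [m] parts; both
    contain the generic ones. *)
Section comparison.
Context (R : realType) (m n : nat) (S : {fset intpart}).
Hypothesis S_le : forall k, k \in S -> partitions_le n m k.
Hypothesis S_strict : forall k : intpart, sumn k = n -> strict_parts m k -> k \in S.

(** Sorting maps the generic compositions onto the partitions with [m] distinct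
    parts, and the fibres are the sets of all [m`!] rearrangements. *)
Lemma sum_generic (h : seq nat -> R) : (forall s t, perm_eq s t -> h s = h t) ->
  \sum_(s <- compositions m n | generic s) h s =
  m`!%:R * \sum_(k <- S | strict_parts m k) h k.
Proof.
move=> hP.
(* In the inner sum only the summand of the sorted s can differ from 0. *)
transitivity (\sum_(s <- compositions m n | generic s)
    \sum_(k <- S | strict_parts m k) if perm_eq s k then h s else 0).
  rewrite big_seq_cond [RHS]big_seq_cond; apply: eq_bigr => s /andP[sm gs].
  move: sm; rewrite mem_compositions => /andP[/eqP sm /eqP sn].
  have sk : perm_eq s (sort_partition s) by rewrite sort_partition_perm.
  have kstrict : strict_parts m (sort_partition s).
    rewrite /strict_parts -(perm_size sk) sm eqxx -(perm_uniq sk).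
    by case/andP: gs.
  have kS : sort_partition s \in S.
    by apply: S_strict => //; rewrite -sn; apply/esym/perm_sumn.
  rewrite -big_mkcondr /= (eq_bigl (fun k => k == sort_partition s)).
    rewrite big_mkcond (bigD1_seq (sort_partition s)) ?fset_uniq//= eqxx big1 ?addr0//.
    by move=> k /negbTE ->.
  move=> k; rewrite sort_partition_perm//; case: eqP => [->|]; rewrite ?andbF//.
  by rewrite kstrict.
rewrite exchange_big //= mulr_sumr.
rewrite big_seq_cond [RHS]big_seq_cond; apply: eq_bigr => k /andP[kS /andP[/eqP km ku]].
rewrite -big_mkcondr /=.
transitivity (\sum_(s <- permutations k) h s).
  rewrite -[LHS]big_filter; apply: perm_big; apply: uniq_perm => [||s].
  - exact/filter_uniq/compositions_uniq.
  - exact: permutations_uniq.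
  rewrite mem_permutations mem_filter mem_compositions.
  have [sk|] := boolP (perm_eq s k); rewrite ?andbF//= andbT.
  rewrite (perm_size sk) km eqxx /generic (perm_uniq sk) ku (perm_mem sk) intpart_gt0 /=.
  by rewrite (perm_sumn sk); have [-> _] := S_le kS; rewrite eqxx.
rewrite big_seq (eq_bigr (fun=> h k)); last first.
  by move=> s; rewrite mem_permutations => /hP.
by rewrite -big_seq big_const_seq count_predT iter_addr_0 size_permutations// km mulr_natl.
Qed.

(** Padding with zeros maps the other partitions injectively to non-generic
    compositions. *)
Lemma count_nonstrict :
  (count (predC (strict_parts m)) S <= count (predC generic) (compositions m n))%N.
Proof.
rewrite -!size_filter -(size_map (fun k : intpart => pad m k)).
apply: uniq_leq_size.
  by rewrite map_inj_uniq ?filter_uniq ?fset_uniq//; exact: pad_inj.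
move=> s /mapP[k]; rewrite mem_filter => /andP[ks kS] ->.
rewrite mem_filter pad_compositions ?andbT; last exact: S_le.
by rewrite /= generic_pad//; have [] := S_le kS.
Qed.

(** Both sums have the same generic part; the remaining terms are bounded by their
    number. *)
Lemma sum_comparison (h : seq nat -> R) M :
  (forall s t, perm_eq s t -> h s = h t) -> (forall s, `|h s| <= M) ->
  `|m`!%:R * (\sum_(k <- S) h k) - \sum_(s <- compositions m n) h s| <=
  (m`!%:R + 1) * M * (count (predC generic) (compositions m n))%:R.
Proof.
move=> hP hM.
have M0 : 0 <= M by apply: le_trans (hM [::]).
have bd (T : Type) (r : seq T) (P : pred T) (g : T -> R) : (forall x, `|g x| <= M) ->
    `|\sum_(x <- r | P x) g x| <= M * (count P r)%:R.
  move=> gM; apply: le_trans (ler_norm_sum _ _ _) _.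
  apply: (@le_trans _ _ (\sum_(x <- r | P x) M)); first by apply: ler_sum.
  by rewrite big_const_seq iter_addr_0 mulr_natr.
rewrite (bigID (strict_parts m)) /= [X in _ - X](bigID generic) /= sum_generic//.
set A1 := \sum_(_ <- _ | _) _; set A2 := \sum_(_ <- _ | ~~ _) _.
set A3 := \sum_(_ <- _ | ~~ _) _.
rewrite (_ : _ - _ = m`!%:R * A2 - A3); last by ring.
apply: le_trans (ler_normB _ _) _; rewrite normrM normr_nat.
rewrite -mulrA mulrDl mul1r; apply: lerD; last exact: bd.
apply: ler_wpM2l => //; apply: le_trans (bd _ _ _ _ _) _ => //.
by apply: ler_wpM2l => //; rewrite ler_nat; exact: count_nonstrict.
Qed.

End comparison.

(** * The eigenvalue of a uniform partition *)

Lemma integral_uniform_on (R : realType) (S : set intpart) (g : intpart -> R) (M : R) :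
  finite_set S -> S !=set0 -> (forall k, `|g k| <= M) ->
  (\int[uniform_on S]_k (g k)%:E =
   ((\sum_(k <- fset_set S) g k) / #|` fset_set S|%:R)%:E)%E.
Proof.
move=> finS S0 gM.
have mg : measurable_fun [set: intpart] g by [].
rewrite (@negligible_integral _ _ _ _ _ (~` S))//; last 2 first.
- exact: bounded_probability_integrable gM.
- by apply: etrans (uniform_onE _ finS S0) _; rewrite setICr fset_set0 cardfs0 mul0r.
rewrite setTD setCK -[X in integral _ X](fset_setK finS).
rewrite (_ : [set` fset_set S] = \big[setU/set0]_(k <- fset_set S) [set k]); last first.
  rewrite -bigcup_seq; apply/seteqP; split => k /=; first by move=> ?; exists k.
  by move=> [l] ? /= ->.
rewrite (@integral_partition _ _ _ (uniform_on S) _ _ _ g) //; last 3 first.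
- exact: fset_uniq.
- by move=> k l _ _ [x [-> ->]].
- by move=> k x ->.
rewrite mulr_suml -sumEFin big_seq [RHS]big_seq; apply: eq_bigr => k kS.
rewrite EFinM; congr (_ * _)%E.
have Sk : S k by move: kS; rewrite in_fset_set// => /set_mem.
apply: etrans (uniform_onE _ finS S0) _; rewrite (_ : S `&` [set k] = [set k]); last first.
  by apply/seteqP; split => x /= => [[]//|->].
by rewrite fset_set1 cardfs1 mul1r.
Qed.

(** This is twice the formula for a(kappa') as the sum of the binomials
    (k_i choose 2), written without subtraction. Exchange the sum over the columns
    [i] with the sum over the parts [j] that reach them. *)
Lemma part_a_conj (k : intpart) :
  (2 * part_a (conj_parts k) + sumn k = sum_squares k)%N.
Proof.
have -> : (part_a (conj_parts k) = \sum_(j <- k) \sum_(i < j) i)%N.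
  rewrite /part_a /conj_parts size_map size_iota.
  under [LHS]eq_bigr => i _.
    rewrite (nth_map 0%N) ?size_iota// nth_iota// add0n -sum1_count big_distrr /=.
    over.
  rewrite (exchange_big_dep xpredT) //= big_seq [RHS]big_seq; apply: eq_bigr => j jk.
  have jh : (j <= head 0%N k)%N.
    have := intpart_sorted k; case: (k : seq nat) jk => // x s; rewrite inE /=.
    move=> /predU1P[->//|js] /(order_path_min geq_trans)/allP/(_ _ js) //.
  rewrite (big_ord_widen_cond _ xpredT (fun i => i) jh) /=.
  by apply: eq_bigr => i _; rewrite muln1.
rewrite /sum_squares sumnE; elim: (k : seq nat) => [|x s IH]; first by rewrite !big_nil.
rewrite !big_cons /= -IH.
have : (2 * (\sum_(i < x) i) + x = x ^ 2)%N.
  rewrite -mulnn; elim: x => [|x IHx]; first by rewrite big_ord0.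
  by move: IHx; rewrite big_ord_recr /=; move: (\sum_(i < x) i)%N => N; nia.
by move=> <-; rewrite mulnDr addnACA.
Qed.

Lemma part_a_le m (s : seq nat) : (size s <= m)%N -> (part_a s <= m * sumn s)%N.
Proof.
move=> sm; rewrite /part_a sumnE (big_nth 0%N) big_mkord big_distrr /=.
by apply: leq_sum => i _; rewrite leq_mul2r; apply/orP; right; have := ltn_ord i; lia.
Qed.

Lemma scaled_eigenvalue_approx (R : realType) (alpha : R) m n k :
  0 < alpha -> (0 < n)%N -> partitions_le n m k ->
  `|alpha / 2 * square_ratio R k - scaled_eigenvalue alpha m n k| <=
    (2 * m%:R + 1 + alpha) / n%:R.
Proof.
move=> a0 n0 [kn km].
have n0R : 0 < n%:R :> R by rewrite ltr0n.
have := part_a_le km; rewrite kn -(ler_nat R) natrM => ak.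
have := part_a_conj k; rewrite kn => /(congr1 (fun i : nat => i%:R : R)).
rewrite natrD natrM => Qk.
rewrite /scaled_eigenvalue /eigenvalue_of /square_ratio kn -Qk.
set A := (part_a (conj_parts k))%:R; set B := (part_a k)%:R.
have B0 : 0 <= B by rewrite ler0n.
have -> : alpha / 2 * ((2%:R * A + n%:R) / n%:R ^+ 2) -
   (n%:R * (m%:R - 1) + A * alpha - B) / n%:R ^+ 2 =
   (alpha / 2 * n%:R - n%:R * (m%:R - 1) + B) / n%:R / n%:R.
  by field; rewrite gt_eqF.
rewrite !normrM normfV (gtr0_norm n0R).
rewrite ler_pM2r ?invr_gt0// ler_pdivrMr//.
have m0 : 0 <= m%:R :> R by rewrite ler0n.
rewrite -/B in ak.
have : 0 <= alpha * n%:R by rewrite mulr_ge0// ltW.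
have : 0 <= m%:R * n%:R :> R by rewrite mulr_ge0// ltW.
by rewrite ler_norml => p1 p2; apply/andP; split; nra.
Qed.

Lemma square_ratio_perm (R : realType) s t : perm_eq s t -> square_ratio R s = square_ratio R t.
Proof.
move=> st; rewrite /square_ratio (perm_sumn st); congr (_%:R / _).
by apply: perm_sumn; exact: perm_map.
Qed.

(** * Weak convergence for uniform partitions *)

Section partition_means.
Context (R : realType) (m : nat).
Hypothesis m0 : (0 < m)%N.

(** The quotient of the numbers of compositions with [m] and with [m.+1] parts is
    [m / (n + m)]. *)
Lemma nongeneric_negligible :
  (fun n => (count (predC generic) (compositions m.+1 n))%:R / (size (compositions m.+1 n))%:R : R)
    @ \oo --> (0 : R).
Proof.
have H : (fun n : nat => (m.+1 * m.+1 * m)%:R * n%:R^-1 : R)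
    @ \oo --> ((m.+1 * m.+1 * m)%:R * 0 : R).
  by apply: cvgMr; exact: cvg_invn.
rewrite mulr0 in H; apply: squeeze_cvgr (cvg_cst 0) H.
near=> n; have n0 : (0 < n)%N by near: n; exists 1%N.
have C0 : (0 < size (compositions m.+1 n))%N by rewrite size_compositions bin_gt0 leq_addl.
rewrite divr_ge0//= ler_pdivrMr ?ltr0n// mulrAC ler_pdivlMr ?ltr0n//.
rewrite -!natrM ler_nat.
have := count_nongeneric_compositions m n.
move: m0; case: (m) => // k _ H; move: (leq_mul H (leqnn n)) => /leq_trans; apply.
rewrite -!mulnA !leq_mul2l /= !size_compositions.
have := mul_bin_diag (n + k).+1 k; rewrite /= addnS => <-.
by rewrite mulnC leq_mul2r; apply/orP; right; lia.
Unshelve. all: end_near. Qed.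

Variable S : nat -> set intpart.
Hypothesis S_le : forall n, S n `<=` partitions_le n m.+1.
Hypothesis S_strict : forall n (k : intpart), sumn k = n -> strict_parts m.+1 k -> S n k.

Let S_fin n : finite_set (S n).
Proof. exact: sub_finite_set (@S_le n) (finite_partitions_le _ _). Qed.

Lemma sum_partitions_cvg (h : seq nat -> R) (M L : R) :
  (forall s t, perm_eq s t -> h s = h t) -> (forall s, `|h s| <= M) ->
  (fun n => mean (compositions m.+1 n) h) @ \oo --> L ->
  (fun n => (m.+1)`!%:R * (\sum_(k <- fset_set (S n)) h k) / (size (compositions m.+1 n))%:R)
    @ \oo --> L.
Proof.
move=> hP hM hL.
pose c := ((m.+1)`!%:R + 1) * M.
have : (fun n => mean (compositions m.+1 n) h +
  ((m.+1)`!%:R * (\sum_(k <- fset_set (S n)) h k) / (size (compositions m.+1 n))%:R -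
   mean (compositions m.+1 n) h)) @ \oo --> L + 0; last first.
  by rewrite addr0; under eq_fun do rewrite addrC subrK.
apply: cvgD => //; apply/cvgr0Pnorm_le => e e0.
have : (fun n => c * ((count (predC generic) (compositions m.+1 n))%:R /
    (size (compositions m.+1 n))%:R))
    @ \oo --> c * 0 by apply: cvgMr; exact: nongeneric_negligible.
rewrite mulr0 => /cvgr0Pnorm_le/(_ _ e0); apply: filterS => n.
apply: le_trans; rewrite /mean -mulrBl mulrA 2!normrM.
apply: ler_wpM2r => //.
apply: le_trans (@sum_comparison R m.+1 n (fset_set (S n)) _ _ h M hP hM) _.
- by move=> k; rewrite in_fset_set// => /set_mem/S_le.
- by move=> k kn ks; rewrite in_fset_set// mem_set//; exact: S_strict.
- exact: ler_norm.
Qed.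

(** The case [h = 1] of the previous lemma, which normalizes the averages. *)
Lemma card_partitions_cvg :
  (fun n => (m.+1)`!%:R * (#|` fset_set (S n)|)%:R / (size (compositions m.+1 n))%:R : R)
    @ \oo --> (1 : R).
Proof.
have E n : (#|` fset_set (S n)|)%:R = \sum_(k <- fset_set (S n)) (1 : R).
  by rewrite big_const_seq count_predT iter_addr_0.
under eq_fun do rewrite E.
apply: (@sum_partitions_cvg (fun=> 1) 1) => // [s|]; first by rewrite normr1.
rewrite (_ : (fun n => _) = fun=> 1); first exact: cvg_cst.
apply/funext => n; rewrite /mean big_const_seq count_predT iter_addr_0 divff//.
by rewrite size_compositions pnatr_eq0 -lt0n bin_gt0 leq_addl.
Qed.

Lemma near_card_partitions :
  \forall n \near \oo, (#|` fset_set (S n)|)%:R != 0 :> R.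
Proof.
have := card_partitions_cvg => /cvgrPdist_lt/(_ 1 ltr01); apply: filterS => n.
by apply: contraTneq => ->; rewrite mulr0 mul0r subr0 normr1 ltxx.
Qed.

Lemma mean_partitions_cvg (h : seq nat -> R) (M L : R) :
  (forall s t, perm_eq s t -> h s = h t) -> (forall s, `|h s| <= M) ->
  (fun n => mean (compositions m.+1 n) h) @ \oo --> L ->
  (fun n => (\sum_(k <- fset_set (S n)) h k) / (#|` fset_set (S n)|)%:R) @ \oo --> L.
Proof.
move=> hP hM hL.
pose C n : R := (size (compositions m.+1 n))%:R.
have XY : (fun n => ((m.+1)`!%:R * (\sum_(k <- fset_set (S n)) h k) / C n) /
    ((m.+1)`!%:R * (#|` fset_set (S n)|)%:R / C n)) @ \oo --> L / 1.
  apply: cvgM; first exact: sum_partitions_cvg hP hM hL.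
  by apply: cvgV; [exact: oner_neq0|exact: card_partitions_cvg].
rewrite divr1 in XY.
apply: cvg_trans XY; apply: near_eq_cvg; near=> n.
have S0 : (#|` fset_set (S n)|)%:R != 0 :> R by near: n; exact: near_card_partitions.
have C0 : C n != 0.
  by rewrite /C size_compositions pnatr_eq0 -lt0n bin_gt0 leq_addl.
have F0 : (m.+1)`!%:R != 0 :> R by rewrite pnatr_eq0 -lt0n fact_gt0.
by rewrite /=; field; rewrite S0 C0 F0.
Unshelve. all: end_near. Qed.

Lemma partitions_weak_cvg (alpha : R) (f : R -> R) (M L : R) : 0 < alpha ->
  continuous f -> (forall x, `|f x| <= M) ->
  (fun n => mean (compositions m.+1 n) (fun s => f (alpha / 2 * square_ratio R s))) @ \oo --> L ->
  (fun n => \int[distribution (uniform_on (S n)) (scaled_eigenvalue alpha m.+1 n)]_x (f x)%:E)%E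
    @ \oo --> L%:E.
Proof.
move=> a0 cf fM fL.
have mf : measurable_fun [set: R] f by exact: continuous_measurable_fun.
pose z n := (\sum_(k <- fset_set (S n)) f (scaled_eigenvalue alpha m.+1 n k)) /
  (#|` fset_set (S n)|)%:R.
have zL : z @ \oo --> L.
  pose y n := (\sum_(k <- fset_set (S n)) f (alpha / 2 * square_ratio R k)) /
    (#|` fset_set (S n)|)%:R.
  have yL : y @ \oo --> L.
    apply: (@mean_partitions_cvg (fun s => f (alpha / 2 * square_ratio R s)) M) => //.
    by move=> s t /(square_ratio_perm R) ->.
  have : (fun n => y n + (z n - y n)) @ \oo --> L + 0; last first.
    by rewrite addr0; under eq_fun do rewrite addrC subrK.
  apply: cvgD => //; apply/cvgr0Pnorm_le => e e0.
  have [d d0 fd] := continuous_uniform_segment 0 (alpha / 2) cf e0.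
  have D0 : (fun n : nat => (2 * (m.+1)%:R + 1 + alpha) * n%:R^-1) @ \oo -->
      (2 * (m.+1)%:R + 1 + alpha) * 0 by apply: cvgMr; exact: cvg_invn.
  rewrite mulr0 in D0; move/cvgr0Pnorm_lt: D0 => /(_ _ d0) D0.
  near=> n.
  have n0 : (0 < n)%N by near: n; exists 1%N.
  have Dn : `|(2 * (m.+1)%:R + 1 + alpha) * n%:R^-1| < d by near: n; exact: D0.
  have S0 : (#|` fset_set (S n)|)%:R != 0 :> R by near: n; exact: near_card_partitions.
  rewrite /z /y -mulrBl -sumrB normrM normfV normr_nat.
  have Spos : 0 < (#|` fset_set (S n)|)%:R :> R by rewrite lt0r S0 ler0n.
  rewrite ler_pdivrMr//; apply: le_trans (ler_norm_sum _ _ _) _.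
  apply: (@le_trans _ _ (\sum_(k <- fset_set (S n)) e)); last first.
    by rewrite big_const_seq count_predT iter_addr_0 mulr_natr.
  rewrite big_seq [leRHS]big_seq; apply: ler_sum => k.
  rewrite in_fset_set// => /set_mem/S_le kS; rewrite distrC; apply: fd.
    have /andP[r0 r1] := square_ratio01 R k.
    by rewrite in_itv /= mulr_ge0 ?divr_ge0 ?(ltW a0)//= ler_piMr// divr_ge0// ltW.
  apply: le_lt_trans (scaled_eigenvalue_approx a0 n0 kS) _.
  exact: le_lt_trans (ler_norm _) Dn.
have : (EFin \o z) @ \oo --> L%:E by apply: cvg_EFin => //; exact: nearW.
apply: cvg_trans; apply: near_eq_cvg; near=> n.
have S0 : (#|` fset_set (S n)|)%:R != 0 :> R by near: n; exact: near_card_partitions.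
have [k kS] : S n !=set0.
  apply/set0P; apply: contraNneq S0 => ->.
  by rewrite fset_set0 cardfs0.
have b (k' : intpart) : `|f (scaled_eigenvalue alpha m.+1 n k')| <= M by exact: fM.
rewrite /= integral_distribution//=.
- by rewrite (integral_uniform_on _ _ b)//; exists k.
- exact/measurable_EFinP.
- by apply: (bounded_probability_integrable (uniform_on (S n)) _ b).
Unshelve. all: end_near. Qed.

End partition_means.

Theorem theorem1 (R : realType) (alpha : R) (halpha : 0 < alpha)
    (m : nat) (hm : (2 <= m)%N)
    (d : measure_display) (T : measurableType d) (P : probability T R)
    (xi : 'I_m -> {RV P >-> R})
    (hindep : mutually_independent P xi)
    (hdens : forall i, has_density P (xi i)
               (fun x => expR (- x) * \1_`[0, +oo[ x)) :
  weakly_converges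
    (fun n => distribution (uniform_on (partitions_le n m))
                           (scaled_eigenvalue alpha m n))
    (distribution P (limit_stat alpha xi))
  /\
  weakly_converges
    (fun n => distribution (uniform_on (partitions_eq n m))
                           (scaled_eigenvalue alpha m n))
    (distribution P (limit_stat alpha xi)).
Proof.
case: m hm xi hindep hdens => // m hm xi hindep hdens.
suff H (S : nat -> set intpart) : (forall n, S n `<=` partitions_le n m.+1) ->
    (forall n (k : intpart), sumn k = n -> strict_parts m.+1 k -> S n k) ->
    weakly_converges
      (fun n => distribution (uniform_on (S n)) (scaled_eigenvalue alpha m.+1 n))
      (distribution P (limit_stat alpha xi)).
  split; apply: H => n k //.
  - by move=> kn /andP[/eqP km _]; split; rewrite // km.
  - by move=> [kn km]; split; rewrite // km.
  - by move=> kn /andP[/eqP km _].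
move=> S_le S_strict f cf [M0 [_ fM0]].
have {fM0} fM x : `|f x| <= M0 + 1 by apply: fM0 => //; rewrite ltrDl.
pose g x := f (alpha / 2 * x).
have cg : continuous g.
  by move=> x; apply: continuous_comp; [exact: mulrl_continuous|exact: cf].
have /cvg_ex[L gL] := @mean_cvg R g m cg.
have gM x : `|g x| <= M0 + 1 by exact: fM.
have -> : (\int[distribution P (limit_stat alpha xi)]_x (f x)%:E = L%:E)%E.
  rewrite integral_distribution//=.
  - exact: (integral_variable_ratio hindep hdens (ltn0Sn m) cg gM gL).
  - by apply/measurable_EFinP; exact: continuous_measurable_fun.
  - apply: (@bounded_probability_integrable _ _ _ P
      (fun w => f (limit_stat alpha xi w)) (M0 + 1)) => //.
    apply: measurableT_comp; [exact: continuous_measurable_fun|exact: measurable_limit_stat].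
exact: (partitions_weak_cvg hm S_le S_strict halpha cf fM gL).
Qed.
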